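(* Let $R$ be a nonzero ring. The following are equivalent: (1) For any unit $u$ of $R$, $u+1$ is either a unit or nilpotent. (2) $R$ is unit-additive. (3) The set $U(R)\cup\mathcal{N}(R)$ is a subring of $R$. (4) The set $U(R)\cup\mathcal{N}(R)$ is a zero-dimensional local subring of $R$. (5) For any finite list $u_1,\ldots,u_n$ of units of $R$, $\sum_{i=1}^n u_i$ is either a unit or nilpotent. If $R$ is a reduced ring, then the following condition is also equivalent to conditions (1), (2), (3), (4) and (5): (6) The set $U(R)\cup\{0\}$, with structure inherited from $R$, is a field.
   Context: All rings are commutative and unital. $U(R)$ is the group of units and $\mathcal{N}(R)$ the nilradical of $R$. A ring $R$ is unit-additive if whenever $u,v$ are units of $R$, $u+v$ is either a unit of $R$ or a nilpotent element. ''Zero-dimensional'' refers to Krull dimension; ''local'' means having a unique maximal ideal. *)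

(* Defs.v *)
From HB Require Import structures.
From mathcomp Require Import all_boot all_order all_algebra.
From mathcomp Require Import boolp.

Set Implicit Arguments.
Unset Strict Implicit.
Unset Printing Implicit Defensive.

Import GRing.Theory.
Local Open Scope ring_scope.

Definition nilpotent (R : comNzRingType) (x : R) : Prop :=
  exists n : nat, x ^+ n = 0.

Definition nilradical (R : comNzRingType) : {pred R} :=
  [pred x : R | `[< nilpotent x >]].
Arguments nilradical : clear implicits.

Definition reduced (R : comNzRingType) : Prop :=
  forall x : R, nilpotent x -> x = 0.

Definition unit_additive (R : comUnitRingType) : Prop :=
  forall u v : R, u \is a GRing.unit -> v \is a GRing.unit ->
    u + v \is a GRing.unit \/ nilpotent (u + v).

Definition unit_or_nil (R : comUnitRingType) : {pred R} :=
  [pred x : R | (x \is a GRing.unit) || (x \in nilradical R)].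
Arguments unit_or_nil : clear implicits.

Definition unit_or_zero (R : comUnitRingType) : {pred R} :=
  [pred x : R | (x \is a GRing.unit) || (x == 0)].
Arguments unit_or_zero : clear implicits.

(* In the library, [idealr_closed] already requires the ideal to be proper. *)
Definition prime_ideal (A : comNzRingType) (P : {pred A}) : Prop :=
  idealr_closed P /\ prime_idealr_closed P.

Definition maximal_ideal (A : comNzRingType) (M : {pred A}) : Prop :=
  idealr_closed M /\
  forall I : {pred A}, idealr_closed I -> {subset M <= I} -> I =i M.

Definition local_ring (A : comNzRingType) : Prop :=
  exists M : {pred A}, maximal_ideal M /\
    forall M' : {pred A}, maximal_ideal M' -> M' =i M.

(* A chain of length n has n.+1 primes P_0 < ... < P_n. *)
Definition prime_chain (A : comNzRingType) (n : nat)
    (P : 'I_n.+1 -> {pred A}) : Prop :=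
  (forall i, prime_ideal (P i)) /\
  (forall i j : 'I_n.+1, (i < j)%N ->
     {subset P i <= P j} /\ ~ {subset P j <= P i}).

Definition has_krull_dim (A : comNzRingType) (n : nat) : Prop :=
  (exists P : 'I_n.+1 -> {pred A}, prime_chain P) /\
  (forall (m : nat) (P : 'I_m.+1 -> {pred A}), prime_chain P -> (m <= n)%N).

Definition zero_dimensional (A : comNzRingType) : Prop := has_krull_dim A 0.

(* [comNzRingType] already guarantees 1 <> 0. *)
Definition is_field (A : comNzRingType) : Prop :=
  forall x : A, x != 0 -> exists y : A, x * y = 1.

(* The proof [hS] is a parameter of the type so that the ring structure
   inherited from R can be inferred from it. *)
Record subring_of (R : comNzRingType) (S : {pred R})
    (hS : GRing.subring_closed S) := SubringOf {
  subring_val : R;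
  subring_valP : subring_val \in S
}.

Section SubringRing.
Variables (R : comNzRingType) (S : {pred R}) (hS : GRing.subring_closed S).

HB.instance Definition _ := [isSub for @subring_val R S hS].
HB.instance Definition _ := [Choice of subring_of hS by <:].
HB.instance Definition _ :=
  GRing.SubChoice_isSubComNzRing.Build R S (subring_of hS) hS.

End SubringRing.

(* Main.v *)
(* An element of S = U(R) \cup N(R) that is not nilpotent has its inverse in S,
   so once S is a subring its nilradical contains every proper ideal; as it is
   also contained in every prime, it is the only prime ideal of S. *)
Require Import Defs.
From HB Require Import structures.
From mathcomp Require Import all_boot all_order all_algebra.
From mathcomp Require Import boolp.

Set Implicit Arguments.
Unset Strict Implicit.
Unset Printing Implicit Defensive.

Import GRing.Theory.
Local Open Scope ring_scope.

(** * Nilpotent elements and the nilradical *)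

Section Nilpotent.
Variable A : comNzRingType.
Implicit Types x y : A.

Lemma nilpotent0 : nilpotent (0 : A).
Proof. by exists 1%N; rewrite expr1. Qed.

Lemma nilpotent1F : ~ nilpotent (1 : A).
Proof. by case=> n /eqP; rewrite expr1n oner_eq0. Qed.

Lemma nilpotentMl a x : nilpotent x -> nilpotent (a * x).
Proof. by case=> n xn0; exists n; rewrite exprMn xn0 mulr0. Qed.

Lemma nilpotentD x y : nilpotent x -> nilpotent y -> nilpotent (x + y).
Proof.
move=> [m xm0] [n yn0]; exists (m + n)%N; rewrite exprDn big1 // => i _.
(* The term of index [i] is a multiple of [x ^+ (m + n - i) * y ^+ i]: the first factor vanishes
   when [i <= n], the second when [n < i]. *)
have [le_in | lt_ni] := leqP i n.
  by rewrite -addnBA // exprD xm0 !mul0r mul0rn.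
by rewrite -(subnKC (ltnW lt_ni)) (exprD y) yn0 mul0r mulr0 mul0rn.
Qed.

Lemma nilpotentN x : nilpotent x -> nilpotent (- x).
Proof. by rewrite -mulN1r; exact: nilpotentMl. Qed.

Lemma in_nilradical x : x \in nilradical A <-> nilpotent x.
Proof. by rewrite inE; split=> /asboolP. Qed.

Lemma nilradical_idealr_closed : idealr_closed (nilradical A).
Proof.
split; first by apply/in_nilradical; exact: nilpotent0.
  by apply/negP => /in_nilradical; exact: nilpotent1F.
move=> a x y /in_nilradical nx /in_nilradical ny; apply/in_nilradical.
by apply: nilpotentD => //; apply: nilpotentMl.
Qed.

Lemma prime_ideal_nilradical (P : {pred A}) :
  prime_ideal P -> {subset nilradical A <= P}.
Proof.
move=> [[P0 P1 _] Pprime] x /in_nilradical [n xn0].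
have: x ^+ n \in P by rewrite xn0.
(* Primality strips one factor [x] at a time; exponent 0 would put 1 in [P], which properness
   forbids. *)
elim: n {xn0} => [|n IHn]; first by rewrite expr0 (negPf P1).
by rewrite exprS => /Pprime/orP[].
Qed.

End Nilpotent.

(** If [x ^+ n = 0], then [u - x] divides [u ^+ n - x ^+ n = u ^+ n], a unit. *)
Lemma unitrB_nilpotent (R : comUnitRingType) (u x : R) :
  u \is a GRing.unit -> nilpotent x -> u - x \is a GRing.unit.
Proof.
move=> Uu [n xn0]; have := unitrX n Uu.
by rewrite -[u ^+ n]subr0 -xn0 subrXX unitrM => /andP[].
Qed.

(** * Rings in which every element is nilpotent or invertible *)

Section InvertibleOrNilpotent.
Variable A : comNzRingType.
Hypothesis invertible_or_nilpotent :
  forall x : A, nilpotent x \/ exists y, x * y = 1.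

Lemma idealr_sub_nilradical (I : {pred A}) :
  idealr_closed I -> {subset I <= nilradical A}.
Proof.
move=> [I0 /negP I1 IZ] x Ix; apply/in_nilradical.
have [// | [y xy1]] := invertible_or_nilpotent x; case: I1.
(* Closure under [a * x + z], taken at [a = y] and [z = 0], puts 1 in [I]. *)
by have := IZ y x 0 Ix I0; rewrite addr0 mulrC xy1.
Qed.

Lemma prime_ideal_eq_nilradical (P : {pred A}) :
  prime_ideal P -> P =i nilradical A.
Proof.
move=> primeP x; apply/idP/idP; last exact: prime_ideal_nilradical.
by case: primeP => /idealr_sub_nilradical idP _; exact: idP.
Qed.

Lemma nilradical_prime_ideal : prime_ideal (nilradical A).
Proof.
split=> [|x y]; first exact: nilradical_idealr_closed.
move=> /in_nilradical nxy; apply/orP.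
have [nx | [z xz1]] := invertible_or_nilpotent x.
  by left; apply/in_nilradical.
right; apply/in_nilradical.
(* With [z] inverse to [x], the element [y] is the multiple [z * (x * y)] of a nilpotent. *)
by rewrite -[y]mul1r -xz1 mulrAC mulrC; exact: nilpotentMl.
Qed.

Lemma invertible_or_nilpotent_zero_dimensional : zero_dimensional A.
Proof.
split.
  exists (fun=> nilradical A); split=> [_ | i j]; last by rewrite !ord1.
  exact: nilradical_prime_ideal.
(* The chain now has length [m.+1], so its first and last primes have distinct indices; both equal
   the nilradical, against strictness. *)
case=> // m P [primeP ltP]; case: (ltP ord0 ord_max (ltn0Sn m)) => _ []x.
by rewrite !(prime_ideal_eq_nilradical (primeP _)).
Qed.

Lemma invertible_or_nilpotent_local : local_ring A.
Proof.
have idN := nilradical_idealr_closed A.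
exists (nilradical A); split=> [|M [idM maxM] x].
  split=> // I idI subNI x; apply/idP/idP; last exact: subNI.
  exact: idealr_sub_nilradical.
by rewrite (maxM (nilradical A)) //; exact: idealr_sub_nilradical.
Qed.

End InvertibleOrNilpotent.

(** * Transfer between a subring and the ambient ring *)

Section Subring.
Variables (R : comUnitRingType) (S : {pred R}) (hS : GRing.subring_closed S).

Lemma subring_of_nilpotent (x : subring_of hS) :
  nilpotent (val x) -> nilpotent x.
Proof. by case=> n xn0; exists n; apply: val_inj; rewrite rmorphXn rmorph0. Qed.

(** The inverse taken in [R] is itself a unit, hence lies in [S]. *)
Lemma subring_of_invertible (x : subring_of hS) :
    {subset GRing.unit <= S} -> val x \is a GRing.unit ->
  exists y, x * y = 1.
Proof.
move=> US Ux; have SVx : (val x)^-1 \in S by apply: US; rewrite unitrV.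
by exists (SubringOf hS SVx); apply: val_inj; rewrite rmorphM rmorph1 divrr.
Qed.

End Subring.

(** * The implications between the conditions *)

Section UnitAdditive.
Variable R : comUnitRingType.
Implicit Types u x y : R.

Lemma in_unit_or_nil x :
  x \in unit_or_nil R <-> x \is a GRing.unit \/ nilpotent x.
Proof.
rewrite inE; split=> [/orP[] | [] ] Sx; [by left | right | by rewrite Sx |].
  exact/in_nilradical.
by apply/orP; right; apply/in_nilradical.
Qed.

(** Factoring out [v] turns [u + v] into a unit times [u / v + 1], where [u / v] is a unit. *)
Lemma unit_additive1 :
  (forall u, u \is a GRing.unit -> u + 1 \is a GRing.unit \/ nilpotent (u + 1)) ->
  unit_additive R.
Proof.
move=> U1 u v Uu Uv; have ->: u + v = v * (u / v + 1).
  by rewrite mulrDr mulr1 mulrC divrK.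
have [|Uw|nw] := U1 (u / v); first by rewrite unitrM Uu unitrV.
  by left; rewrite unitrM Uv.
by right; apply: nilpotentMl.
Qed.

Lemma unit_additive_subring_closed :
  unit_additive R -> GRing.subring_closed (unit_or_nil R).
Proof.
move=> UD; split=> [|x y /in_unit_or_nil Sx /in_unit_or_nil Sy
                    |x y /in_unit_or_nil Sx /in_unit_or_nil Sy].
- by apply/in_unit_or_nil; left; exact: unitr1.
- apply/in_unit_or_nil; case: Sx Sy => [Ux|nx] [Uy|ny].
  + by apply: UD; rewrite ?unitrN.
  + by left; apply: unitrB_nilpotent.
  (* Here the unit is subtracted from the nilpotent, so the sign is flipped first. *)
  + by left; rewrite -opprB unitrN; apply: unitrB_nilpotent.
  + by right; apply: nilpotentD => //; apply: nilpotentN.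
- apply/in_unit_or_nil; case: Sx Sy => [Ux|nx] [Uy|ny].
  + by left; rewrite unitrM Ux.
  + by right; apply: nilpotentMl.
  + by right; rewrite mulrC; apply: nilpotentMl.
  + by right; apply: nilpotentMl.
Qed.

Lemma unit_or_nil_zero_dimensional_local
    (h : GRing.subring_closed (unit_or_nil R)) :
  zero_dimensional (subring_of h) /\ local_ring (subring_of h).
Proof.
have inv (x : subring_of h) : nilpotent x \/ exists y : subring_of h, x * y = 1.
  have /in_unit_or_nil[Ux | nx] := valP x.
    right; apply: subring_of_invertible Ux => u Uu.
    by apply/in_unit_or_nil; left.
  by left; apply: subring_of_nilpotent.
split; first exact: invertible_or_nilpotent_zero_dimensional inv.
exact: invertible_or_nilpotent_local inv.
Qed.

Lemma subring_closed_sum_units (s : seq R) :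
    GRing.subring_closed (unit_or_nil R) ->
    {in s, forall u, u \is a GRing.unit} ->
  \sum_(u <- s) u \is a GRing.unit \/ nilpotent (\sum_(u <- s) u).
Proof.
move=> hS Us; have [_ SD] := GRing.zmod_closedD (GRing.subring_closedB hS).
(* [big_seq] keeps the membership of each summand in [s], from which it is a unit. The empty sum 0
   counts as nilpotent. *)
apply/in_unit_or_nil; rewrite big_seq.
elim/big_ind: _ => [|x y|u su]; last by apply/in_unit_or_nil; left; exact: Us.
  by apply/in_unit_or_nil; right; exact: nilpotent0.
exact: SD.
Qed.

Lemma sum_units_add1 u :
    (forall s : seq R, {in s, forall u, u \is a GRing.unit} ->
       \sum_(u <- s) u \is a GRing.unit \/ nilpotent (\sum_(u <- s) u)) ->
  u \is a GRing.unit -> u + 1 \is a GRing.unit \/ nilpotent (u + 1).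
Proof.
move=> Usum Uu; have := Usum [:: u; 1]; rewrite big_cons big_seq1; apply.
by move=> v; rewrite !inE => /orP[] /eqP->; rewrite ?unitr1.
Qed.

(** Stated as an equality of predicates, not pointwise, so that it can rewrite inside
    [GRing.subring_closed]. *)
Lemma reduced_unit_or_nil : reduced R -> unit_or_nil R = unit_or_zero R.
Proof.
move=> redR; apply: funext => x; apply/idP/idP => [/in_unit_or_nil[Ux | /redR->]|].
- by apply/orP; left.
- by apply/orP; right.
case/orP=> [Ux | /eqP->]; apply/in_unit_or_nil; [by left | right].
exact: nilpotent0.
Qed.

Lemma unit_or_zero_field (h : GRing.subring_closed (unit_or_zero R)) :
  is_field (subring_of h).
Proof.
move=> x x_neq0; apply: subring_of_invertible => [u Uu|].
  by apply/orP; left.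
have /orP[// | /eqP x0] := valP x.
by case/eqP: x_neq0; apply: val_inj; rewrite x0 rmorph0.
Qed.

Lemma unit_or_zero_add1 u :
    GRing.subring_closed (unit_or_zero R) ->
  u \is a GRing.unit -> u + 1 \is a GRing.unit \/ nilpotent (u + 1).
Proof.
move=> h Uu; have: u + 1 \in unit_or_zero R.
  have [_ SD] := GRing.zmod_closedD (GRing.subring_closedB h).
  by apply: SD; apply/orP; left; rewrite ?unitr1.
by case/orP=> [U1 | /eqP->]; [left | right; exact: nilpotent0].
Qed.

End UnitAdditive.

Theorem proposition2p1 (R : comUnitRingType) :
  [<-> (forall u : R, u \is a GRing.unit ->
          u + 1 \is a GRing.unit \/ nilpotent (u + 1));
       unit_additive R;
       GRing.subring_closed (unit_or_nil R);
       (exists h : GRing.subring_closed (unit_or_nil R),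
          zero_dimensional (subring_of h) /\ local_ring (subring_of h));
       (forall s : seq R, {in s, forall u, u \is a GRing.unit} ->
          \sum_(u <- s) u \is a GRing.unit \/ nilpotent (\sum_(u <- s) u))]
  /\
  (reduced R ->
     [<-> (forall u : R, u \is a GRing.unit ->
             u + 1 \is a GRing.unit \/ nilpotent (u + 1));
          unit_additive R;
          GRing.subring_closed (unit_or_nil R);
          (exists h : GRing.subring_closed (unit_or_nil R),
             zero_dimensional (subring_of h) /\ local_ring (subring_of h));
          (forall s : seq R, {in s, forall u, u \is a GRing.unit} ->
             \sum_(u <- s) u \is a GRing.unit \/ nilpotent (\sum_(u <- s) u));
          (exists h : GRing.subring_closed (unit_or_zero R),
             is_field (subring_of h))]).
Proof.
split=> [|redR]; tfae.
(* The cycle (1), (2), (3), (4), (5), (1). *)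
- exact: unit_additive1.
- exact: unit_additive_subring_closed.
- by move=> h; exists h; exact: unit_or_nil_zero_dimensional_local.
- by case=> h _ s; exact: subring_closed_sum_units.
- by move=> Usum u; exact: sum_units_add1.
(* The same cycle, now returning from (5) to (1) through (6). *)
- exact: unit_additive1.
- exact: unit_additive_subring_closed.
- by move=> h; exists h; exact: unit_or_nil_zero_dimensional_local.
- by case=> h _ s; exact: subring_closed_sum_units.
- move=> Usum.
  (* From (5), conditions (1), (2) and (3) follow in turn; reducedness then replaces the nilradical
     by 0. *)
  have h : GRing.subring_closed (unit_or_zero R).
    rewrite -reduced_unit_or_nil //; apply: unit_additive_subring_closed.
    by apply: unit_additive1 => u; exact: sum_units_add1.
  by exists h; exact: unit_or_zero_field.
- by case=> h _ u; exact: unit_or_zero_add1.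
Qed.
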